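(* Let $T_\varepsilon$ be the last time $t$ at which $\max_kx_k(t)-\min_kx_k(t)>\varepsilon$, for $0<\varepsilon<1$. Then $$\mathbb{E}\,T_\varepsilon=O\!\left(\frac{d^2n^4}{p^3\rho^2}\right)\log\frac{n}{\rho\varepsilon}.$$ In particular, in expected time of this order all robots lie within distance $\varepsilon$ of the plane $X=0$ from then on.
   Context: Distributed motion coordination model. Let $G$ be a connected undirected graph on $[n]$ (the robots) without self-loops, and let $R\subseteq[n]$ with $|R|=r$ be the set of robots pinned to the plane $X=0$. Symmetrization: form $G^*$ on $\nu=2n-r$ vertices by adding a mirror copy $i'$ of every $i\notin R$ (with $i'=i$ for $i\in R$). The edges of $G^*$ are the edges of $G$ together with their mirror images $\{i',j'\}$. Weights and parameters: - Assign each vertex $i$ of $G^*$ a weight $a_i$ with $0<a_i<1/(d_i+1)$, where $d_i$ is its degree in $G^*$, and mirror copies receive equal weights. - $d$ is the maximum degree of $G^*$, $\rho=\min_ia_i$, and $p\in(0,1]$. At each time $t$, independently over time, $G_t^*$ is obtained by keeping each edge of $G$ independently with probability $p$ (deleting it with probability $1-p$), together with its mirror image. The matrix $P_t$ is defined by: - $(P_t)_{ij}=a_i$ and $(P_t)_{ji}=a_j$ for each edge $\{i,j\}$ of $G_t^*$; - $(P_t)_{ii}=1-\sum_{j\ne i}(P_t)_{ij}$; - all other entries are $0$. Only the $X$-coordinates matter. Take $x(0)\in\mathbb{R}^\nu$ with $x_i(0)\in[0,1]$ for $i\in[n]$, $x_i(0)=0$ for $i\in R$, and $x_{i'}(0)=-x_i(0)$.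 The dynamics is $x(t+1)=P_tx(t)$.
   Formalization: The set R of pinned robots is assumed nonempty (for r = 0 the claim fails: x(0) = 1 on all robots keeps the spread at 2 forever); the closing ''in particular'' sentence is not stated separately, as it follows at once from the bound by mirror antisymmetry. *)

(* Defs.v *)
From HB Require Import structures.
From mathcomp Require Import all_boot all_order all_algebra.
From mathcomp Require Import all_classical all_reals all_analysis.
Set Implicit Arguments. Unset Strict Implicit. Unset Printing Implicit Defensive.
Import Order.TTheory GRing.Theory Num.Theory.
Local Open Scope ring_scope.
Local Open Scope classical_set_scope.

(* Vertices of the symmetrized graph G*: pairs (i, b) where b = true means the
   mirror copy i'; a mirror copy exists only for i \notin R (for i \in R, i' = i). *)
Definition vok n (R : {set 'I_n}) (v : 'I_n * bool) : bool := v.2 ==> (v.1 \notin R).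
Definition sym_vertex n (R : {set 'I_n}) := {v : 'I_n * bool | vok R v}.

Lemma vtx_ok n (R : {set 'I_n}) (i : 'I_n) (b : bool) : vok R (i, b && (i \notin R)).
Proof. by rewrite /vok /=; case: b => //=; apply/implyP. Qed.

Definition vtx n (R : {set 'I_n}) (i : 'I_n) (b : bool) : sym_vertex R :=
  exist _ (i, b && (i \notin R)) (vtx_ok R i b).

Definition sym_graph n (R : {set 'I_n}) (E : rel 'I_n) : rel (sym_vertex R) :=
  fun u v => [exists i, exists j, exists b,
                [&& E i j, u == vtx R i b & v == vtx R j b]].

Definition Gstar n (G : rel 'I_n) (R : {set 'I_n}) : rel (sym_vertex R) := @sym_graph n R G.

Arguments Gstar {n} G R _ _.

Definition deg n (G : rel 'I_n) (R : {set 'I_n}) (u : sym_vertex R) : nat :=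
  #|[set v | Gstar G R u v]|.

Arguments deg {n} G R u.

Definition maxdeg n (G : rel 'I_n) (R : {set 'I_n}) : nat :=
  \max_(u : sym_vertex R) deg G R u.

Arguments maxdeg {n} G R.

(* Edge {i,j} of G (i <> j) is kept at time t iff kp t (min i j) (max i j). *)
Definition skeep n (k : 'I_n -> 'I_n -> bool) : rel 'I_n :=
  fun i j => if (i < j)%N then k i j else k j i.

Definition Gt n (G : rel 'I_n) (R : {set 'I_n}) (k : 'I_n -> 'I_n -> bool) : rel (sym_vertex R) :=
  @sym_graph n R (fun i j => G i j && skeep k i j).

Arguments Gt {n} G R k _ _.

Definition Poff (Rl : realType) (V : finType) (a : V -> Rl) (A : rel V) (u v : V) : Rl :=
  if (u != v) && A u v then a u else 0.
Definition Pmat (Rl : realType) (V : finType) (a : V -> Rl) (A : rel V) (u v : V) : Rl :=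
  if u == v then 1 - \sum_(w | w != u) Poff a A u w else Poff a A u v.

Fixpoint traj (Rl : realType) (V : finType) (a : V -> Rl) (x0 : V -> Rl)
    (A : nat -> rel V) (t : nat) : V -> Rl :=
  match t with
  | 0 => x0
  | t'.+1 => fun u => \sum_v Pmat a (A t') u v * traj a x0 A t' v
  end.

Definition init (Rl : realType) n (R : {set 'I_n}) (x0 : 'I_n -> Rl)
    (v : sym_vertex R) : Rl :=
  if (val v).2 then - x0 (val v).1 else x0 (val v).1.

Arguments init {Rl n} R x0 v.

Definition spread_gt (Rl : realType) (V : finType) (eps : Rl) (x : V -> Rl) : Prop :=
  exists u v, eps < x u - x v.

(* T_eps: last time t with spread > eps (0 if there is none, +oo if unbounded) *)
Definition Tlast (Rl : realType) (V : finType) (eps : Rl) (x : nat -> V -> Rl) : \bar Rl :=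
  ereal_sup ([set 0%E] `|` [set ((t%:R : Rl)%:E) | t in [set t | spread_gt eps (x t)]]).

Definition indep_bern (Rl : realType) (dsp : measure_display) (Om : measurableType dsp)
    (P : probability Om Rl) (p : Rl) (K : eqType) (I : pred K) (E : K -> set Om) : Prop :=
  forall S : seq K, uniq S -> all I S ->
    P (\big[setI/setT]_(k <- S) E k) = (p ^+ size S)%:E.

(* Main.v *)
Require Import Defs.
From HB Require Import structures.
From mathcomp Require Import all_boot all_order all_algebra.
From mathcomp Require Import all_classical all_reals all_analysis.
From mathcomp Require Import measurable_realfun ring lra.
Import Order.TTheory GRing.Theory Num.Theory.
Local Open Scope ring_scope.
Local Open Scope classical_set_scope.

(** The potential [Phi t = \sum_u x_u(t)^2 / a_u] is a Lyapunov function: one step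
    decreases it by at least [1/(d+1)] times the Dirichlet form of the graph
    [G_t*], and the expectation of that form given the past is [p] times the
    Dirichlet form of [G*].  By antisymmetry the pinned robots stay at [0], so a
    path to a pinned robot gives [x_u^2 <= n^2 Dir], whence [Phi <= (2n^3/rho) Dir]
    and [E Phi] decays geometrically at rate [l = p rho / (2 n^3 (d+1))].  Spread
    [> eps] forces [Phi > eps^2/4], and [Phi] is nonincreasing, so pointwise
    [T_eps <= s + \sum_(k >= s) 4 Phi(k) / eps^2] for every [s]; integrating and
    taking [s] of order [ln (8n / (rho eps^2)) / l] gives a bound of order
    [d n^3 / (p rho) * ln (n / (rho eps))]. *)

(** * Deterministic energy estimates for one step on a fixed graph *)

Section Energy.
Set Implicit Arguments.
Unset Strict Implicit.
Context {Rl : realType} {V : finType}.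
Implicit Types (a x : V -> Rl) (A : rel V) (u v : V).

(** The weight [1 / a u] is the reversing measure of [Pmat a A] for symmetric [A]: on every edge
    [Pmat a A u v / a u] equals 1. *)
Definition energy a x : Rl := \sum_u x u ^+ 2 / a u.

(** Ordered pairs are summed, so for symmetric [A] this is twice the usual sum over undirected
    edges. *)
Definition dirichlet A x : Rl := \sum_u \sum_(v | A u v) (x v - x u) ^+ 2.

Lemma energy_ge0 a x : (forall u, 0 < a u) -> 0 <= energy a x.
Proof.
by move=> a0; apply: sumr_ge0 => u _; rewrite divr_ge0 ?sqr_ge0 // ltW.
Qed.

Lemma dirichlet_ge0 A x : 0 <= dirichlet A x.
Proof. by apply: sumr_ge0 => u _; apply: sumr_ge0 => v _; exact: sqr_ge0. Qed.

(** Each row of [Pmat] sums to 1, so only differences survive: a step is a weighted graph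
    Laplacian. *)
Lemma Pmat_apply a A x u : irreflexive A ->
  \sum_v Pmat a A u v * x v = x u + a u * \sum_(v | A u v) (x v - x u).
Proof.
move=> irrA; rewrite (bigD1 u) //= /Pmat eqxx.
under eq_bigr => v /negbTE vu do rewrite eq_sym vu.
(* Stated for general [F]: [F = x] handles the off-diagonal part, [F = 1] the diagonal deficit. *)
have E (F : V -> Rl) : \sum_(v | v != u) Poff a A u v * F v =
    a u * \sum_(v | A u v) F v.
  rewrite mulr_sumr big_mkcond [RHS]big_mkcond; apply: eq_bigr => v _.
  rewrite /Poff eq_sym; case: eqP => [->|] /=; first by rewrite irrA.
  by case: ifP => // _ _; rewrite mul0r.
have -> : \sum_(w | w != u) Poff a A u w = a u * \sum_(v | A u v) 1.
  by rewrite -(E (fun=> 1)); apply: eq_bigr => w _; rewrite mulr1.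
rewrite E mulrBl mul1r -addrA; congr (_ + _).
rewrite sumrB mulrBr addrC; congr (_ - _).
by rewrite -mulrA mulr_suml; under eq_bigr do rewrite mul1r.
Qed.

(** Cauchy-Schwarz against the constant 1, via Lagrange's identity: the defect is half the sum of
    squared pairwise differences. *)
Lemma sqr_sum_le (I : finType) (D : pred I) (F : I -> Rl) :
  (\sum_(i | D i) F i) ^+ 2 <= #|D|%:R * \sum_(i | D i) F i ^+ 2.
Proof.
suff -> : #|D|%:R * \sum_(i | D i) F i ^+ 2 = (\sum_(i | D i) F i) ^+ 2 +
    2^-1 * \sum_(i | D i) \sum_(j | D j) (F i - F j) ^+ 2.
  rewrite lerDl mulr_ge0 // sumr_ge0 // => i _.
  by rewrite sumr_ge0 // => j _; exact: sqr_ge0.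
have -> : \sum_(i | D i) \sum_(j | D j) (F i - F j) ^+ 2 =
    \sum_(i | D i) (F i ^+ 2 * #|D|%:R - 2 * F i * (\sum_(j | D j) F j)
      + \sum_(j | D j) F j ^+ 2).
  apply: eq_bigr => i _.
  have -> : \sum_(j | D j) (F i - F j) ^+ 2 =
      \sum_(j | D j) (F i ^+ 2 - 2 * F i * F j + F j ^+ 2).
    by apply: eq_bigr => j _; ring.
  by rewrite big_split /= sumrB sumr_const mulr_natr mulr_sumr.
rewrite big_split /= sumrB -!mulr_suml -mulr_sumr sumr_const.
rewrite -[_ *+ #|D|]mulr_natl.
set S := \sum_(i | _) _; set Q := \sum_(i | _) _; set c := #|_|%:R.
by field.
Qed.

(** Summation by parts: swapping the endpoints of every edge gives a second form of the sum, and
    adding the two forms produces minus the squares. *)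
Lemma dirichlet_ibp A x : symmetric A ->
  \sum_u x u * (\sum_(v | A u v) (x v - x u)) = - (2^-1 * dirichlet A x).
Proof.
move=> symA.
have E : \sum_u x u * (\sum_(v | A u v) (x v - x u)) =
         \sum_u \sum_(v | A u v) x u * (x v - x u).
  by apply: eq_bigr => u _; rewrite mulr_sumr.
have E' : \sum_u x u * (\sum_(v | A u v) (x v - x u)) =
         \sum_u \sum_(v | A u v) x v * (x u - x v).
  rewrite E (exchange_big_dep xpredT) //=; apply: eq_bigr => u _.
  by apply: eq_bigl => v; rewrite symA.
have : dirichlet A x = - (2 * \sum_u x u * (\sum_(v | A u v) (x v - x u))).
  rewrite mulr_natl mulr2n {1}E E' -big_split /= -sumrN; apply: eq_bigr => u _.
  rewrite -big_split /= -sumrN; apply: eq_bigr => v _; ring.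
move=> ->; by field.
Qed.

(** Expand the square. The cross term is minus the full Dirichlet form by summation by parts; the
    quadratic term is at most [1 - c] times that form by Cauchy-Schwarz at each vertex. *)
Lemma energy_step a A x (c : Rl) : symmetric A -> irreflexive A ->
  (forall u, 0 < a u) ->
  (forall u, a u * #|[pred v | A u v]|%:R <= 1 - c) ->
  energy a (fun u => \sum_v Pmat a A u v * x v) <= energy a x - c * dirichlet A x.
Proof.
move=> symA irrA a0 ac.
pose D u := \sum_(v | A u v) (x v - x u).
have -> : energy a (fun u => \sum_v Pmat a A u v * x v) =
    energy a x + 2 * (\sum_u x u * D u) + \sum_u a u * D u ^+ 2.
  rewrite mulr_sumr -!big_split /=; apply: eq_bigr => u _.
  rewrite Pmat_apply // -/(D u); field; exact: lt0r_neq0.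
rewrite dirichlet_ibp //.
have : \sum_u a u * D u ^+ 2 <= (1 - c) * dirichlet A x.
  rewrite mulr_sumr; apply: ler_sum => u _.
  apply: (@le_trans _ _ (a u * (#|[pred v | A u v]|%:R *
                                \sum_(v | A u v) (x v - x u) ^+ 2))).
    by rewrite ler_pM2l //; exact: sqr_sum_le.
  rewrite mulrA ler_wpM2r // sumr_ge0 // => v _; exact: sqr_ge0.
lra.
Qed.

Lemma dirichlet_edge A x u v : A u v -> `|x v - x u| <= Num.sqrt (dirichlet A x).
Proof.
move=> Auv; rewrite -sqrtr_sqr ler_wsqrtr // /dirichlet (bigD1 u) //= (bigD1 v) //=.
rewrite -addrA lerDl addr_ge0 // sumr_ge0 // => w _; rewrite ?sqr_ge0 //.
by rewrite sumr_ge0 // => ? _; exact: sqr_ge0.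
Qed.

(** Telescoping, with every single edge bounded by the whole form; the path may therefore repeat
    edges. *)
Lemma dirichlet_path A x u s : path A u s ->
  `|x (last u s) - x u| <= (size s)%:R * Num.sqrt (dirichlet A x).
Proof.
elim: s u => [|v s IH] u /=; first by rewrite subrr normr0 mul0r.
move=> /andP[Auv /IH]; have := dirichlet_edge x Auv => h1 h2.
rewrite -[x (last v s) - _](subrKA (x v)) (le_trans (ler_normD _ _)) //.
by rewrite -natr1 mulrDl mul1r lerD.
Qed.

Lemma sqr_le_energy a x u : (forall u, 0 < a u) -> a u <= 1 ->
  x u ^+ 2 <= energy a x.
Proof.
move=> a0 a1; rewrite /energy (bigD1 u) //=.
apply: (@le_trans _ _ (x u ^+ 2 / a u)).
  by rewrite ler_pdivlMr // ler_piMr // sqr_ge0.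
by rewrite lerDl sumr_ge0 // => v _; rewrite divr_ge0 ?sqr_ge0 // ltW.
Qed.

Lemma energy_le a x (rho B : Rl) : 0 < rho -> (forall u, rho <= a u) ->
  (forall u, x u ^+ 2 <= B) -> energy a x <= #|V|%:R * B / rho.
Proof.
move=> rho0 ra xB.
rewrite -mulrA mulr_natl -sumr_const; apply: ler_sum => u _.
have a0 : 0 < a u := lt_le_trans rho0 (ra u).
rewrite ler_pdivrMr // (le_trans (xB u)) // -mulrA ler_peMr //.
  by apply: le_trans (xB u); exact: sqr_ge0.
by rewrite mulrC ler_pdivlMr // mul1r.
Qed.

(** Two values more than [eps] apart cannot both lie within [eps / 2] of 0, and dividing by
    [a u <= 1] only enlarges the square. *)
Lemma spread_gt_energy a x (eps : Rl) : 0 < eps ->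
  (forall u, 0 < a u) -> (forall u, a u <= 1) ->
  spread_gt eps x -> eps ^+ 2 / 4 <= energy a x.
Proof.
move=> eps0 a0 a1 [u [v]] uv.
have [h|h] : eps / 2 <= x u \/ eps / 2 <= - x v.
  by case: (lerP (eps / 2) (x u)); [left|right; lra].
  by apply: le_trans (sqr_le_energy x a0 (a1 u)); nra.
by apply: le_trans (sqr_le_energy x a0 (a1 v)); nra.
Qed.

End Energy.

(** * Integrating polynomials in independent Bernoulli bits *)

Section BernoulliPolynomials.
Set Implicit Arguments.
Unset Strict Implicit.
Context {Rl : realType} {dsp : measure_display} {Om : measurableType dsp}.
Variables (P : probability Om Rl) (K : eqType) (E : K -> set Om).
Implicit Types (D : pred K) (f g : Om -> Rl).

(* Polynomials in the indicators of the events [E k], [D k]: every function of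
   finitely many of the bits is one, and independence need only be checked on
   monomials. *)
Inductive bitpoly D : (Om -> Rl) -> Prop :=
| bitpoly_cst c : bitpoly D (fun=> c)
| bitpolyD f g : bitpoly D f -> bitpoly D g -> bitpoly D (fun w => f w + g w)
| bitpoly_bit k f : D k -> bitpoly D f -> bitpoly D (fun w => \1_(E k) w * f w).

Lemma bitpoly_sub D D' f : subpred D D' -> bitpoly D f -> bitpoly D' f.
Proof.
move=> DD'; elim=> [c|g h _ ? _ ?|k g Dk _ ?]; first exact: bitpoly_cst.
  exact: bitpolyD.
by apply: bitpoly_bit => //; exact: DD'.
Qed.

Lemma bitpolyZ D c f : bitpoly D f -> bitpoly D (fun w => c * f w).
Proof.
elim=> [c'|g h _ ? _ ?|k g Dk _ ?]; first exact: bitpoly_cst.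
  by under eq_fun do rewrite mulrDr; exact: bitpolyD.
by under eq_fun do rewrite mulrCA; exact: bitpoly_bit.
Qed.

Lemma bitpolyM D f g : bitpoly D f -> bitpoly D g -> bitpoly D (fun w => f w * g w).
Proof.
move=> + Dg; elim=> [c|h1 h2 _ ? _ ?|k h Dk _ ?]; first exact: bitpolyZ.
  by under eq_fun do rewrite mulrDl; exact: bitpolyD.
by under eq_fun do rewrite -mulrA; exact: bitpoly_bit.
Qed.

Lemma bitpolyB D f g : bitpoly D f -> bitpoly D g -> bitpoly D (fun w => f w - g w).
Proof.
move=> Df Dg; under eq_fun do rewrite -[- g _]mulN1r.
by apply: bitpolyD => //; exact: bitpolyZ.
Qed.

Lemma bitpoly_sum D (I : Type) (r : seq I) (Q : pred I) (F : I -> Om -> Rl) :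
  (forall i, Q i -> bitpoly D (F i)) -> bitpoly D (fun w => \sum_(i <- r | Q i) F i w).
Proof.
move=> DF; elim: r => [|i r IH].
  by under eq_fun do rewrite big_nil; exact: bitpoly_cst.
have [Qi|/negbTE Qi] := boolP (Q i); under eq_fun do rewrite big_cons Qi //; last by [].
by apply: bitpolyD => //; exact: DF.
Qed.

Hypothesis mE : forall k, measurable (E k).

Lemma bitpoly_measurable D f : bitpoly D f -> measurable_fun setT f.
Proof.
elim=> [c|g h _ ? _ ?|k g Dk _ ?]; first exact: measurable_cst.
  exact: measurable_funD.
apply: measurable_funM => //; exact: measurable_indic.
Qed.

Lemma bitpoly_bounded D f : bitpoly D f -> exists B, forall w, `|f w| <= B.
Proof.
elim=> [c|g h _ [B1 b1] _ [B2 b2]|k g Dk _ [B b]]; first by exists `|c|.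
  by exists (B1 + B2) => w; rewrite (le_trans (ler_normD _ _)) // lerD.
exists B => w; rewrite normrM (le_trans _ (b w)) // ler_piMl //.
by rewrite indicE; case: (_ \in _); rewrite ?normr0 ?normr1.
Qed.

Lemma bitpoly_integrable D f : bitpoly D f -> P.-integrable setT (EFin \o f).
Proof.
move=> Df; apply: measurable_bounded_integrable => //.
- by rewrite -ge0_fin_numE // fin_num_measure.
- exact: bitpoly_measurable Df.
- have [B b] := bitpoly_bounded Df.
  exists B; split; first exact: num_real.
  by move=> M BM w _ /=; rewrite (le_trans (b w)) // ltW.
Qed.

Lemma Rintegral_bitpoly_sum D (I : Type) (r : seq I) (Q : pred I) (F : I -> Om -> Rl) :
  (forall i, Q i -> bitpoly D (F i)) ->
  \int[P]_w (\sum_(i <- r | Q i) F i w) = \sum_(i <- r | Q i) \int[P]_w F i w.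
Proof.
move=> DF; elim: r => [|i r IH].
  rewrite big_nil; under eq_Rintegral do rewrite big_nil.
  by rewrite Rintegral_cst // mul0r.
rewrite big_cons; have [Qi|/negbTE Qi] := boolP (Q i); last first.
  by under eq_Rintegral do rewrite big_cons Qi.
under eq_Rintegral do rewrite big_cons Qi.
rewrite RintegralD //= ?IH //.
- exact: bitpoly_integrable (DF _ Qi).
- exact: bitpoly_integrable (bitpoly_sum _ DF).
Qed.

Variables (p : Rl) (I : pred K).
Hypothesis indepE : indep_bern P p I E.

Lemma measurable_bigE (s : seq K) : measurable (\big[setI/setT]_(k <- s) E k).
Proof. by elim: s => [|k s IH]; rewrite ?big_nil ?big_cons //; exact: measurableI. Qed.

(** Intersection is idempotent; this reduces arbitrary lists to the duplicate-free ones covered by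
    [indep_bern]. *)
Lemma bigE_undup (s : seq K) :
  \big[setI/setT]_(k <- undup s) E k = \big[setI/setT]_(k <- s) E k.
Proof.
elim: s => //= k s IH; case: ifPn => ks; rewrite !big_cons ?IH //.
apply/esym/setIidr => w; move: ks; elim: s {IH} => // j s IH.
by rewrite inE big_cons => /predU1P[->|ks] [Ej /IH]; [|exact].
Qed.

(** After removing duplicates both probabilities are powers of [p], with exponents differing by
    one. *)
Lemma prob_bit_cons k (s : seq K) : I k -> all I s -> k \notin s ->
  P (E k `&` \big[setI/setT]_(j <- s) E j) =
  (p%:E * P (\big[setI/setT]_(j <- s) E j))%E.
Proof.
move=> Ik Is ks; rewrite -bigE_undup.
have -> : E k `&` \big[setI/setT]_(j <- undup s) E j =
    \big[setI/setT]_(j <- k :: undup s) E j by rewrite big_cons.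
have Iu : all I (undup s) by apply/allP => j; rewrite mem_undup => /(allP Is).
rewrite !indepE ?undup_uniq //= ?Ik ?mem_undup ?ks ?undup_uniq //.
by rewrite exprS EFinM.
Qed.

Lemma Rintegral_indic_cst (A : set Om) c : measurable A ->
  \int[P]_w (\1_A w * c) = fine (P A) * c.
Proof.
move=> mA; rewrite RintegralZr //.
  by rewrite /Rintegral integral_indic // setIT.
exact: integrable_indic.
Qed.

(* Induction on [f], generalized over a list [s] that collects the bits already
   extracted; repetitions in [s] are harmless since indicators are idempotent. *)
Lemma Rintegral_bit D k f : I k -> ~~ D k -> subpred D I -> bitpoly D f ->
  \int[P]_w (\1_(E k) w * f w) = p * \int[P]_w f w.
Proof.
move=> Ik Dk DI Df.
suff gen (s : seq K) : all D s ->
    \int[P]_w (\1_(E k `&` \big[setI/setT]_(j <- s) E j) w * f w) =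
    p * \int[P]_w (\1_(\big[setI/setT]_(j <- s) E j) w * f w).
  have := gen [::] isT; rewrite big_nil setIT => ->; congr (_ * _).
  by apply: eq_Rintegral => w _; rewrite indicT mul1r.
have mS s' : measurable (\big[setI/setT]_(j <- s') E j) by exact: measurable_bigE.
have mkS s' : measurable (E k `&` \big[setI/setT]_(j <- s') E j) by exact: measurableI.
have int A g : measurable A -> bitpoly D g ->
    P.-integrable setT (EFin \o (fun w => \1_A w * g w)).
  move=> mA Dg; apply: measurable_bounded_integrable => //.
  - by rewrite -ge0_fin_numE // fin_num_measure.
  - by apply: measurable_funM; [exact: measurable_indic|exact: bitpoly_measurable Dg].
  - have [B b] := bitpoly_bounded Dg.
    exists B; split; first exact: num_real.
    move=> M BM w _ /=; apply: le_trans (ltW BM); apply: le_trans (b w).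
    rewrite normrM ler_piMl //.
    by rewrite indicE; case: (_ \in _); rewrite ?normr0 ?normr1.
elim: Df s => [c|g h Dg IHg Dh IHh|j g Dj _ IH] s Ds.
(* The constant case is where independence enters; the other two cases only rearrange. *)
- rewrite !Rintegral_indic_cst // prob_bit_cons //; last 2 first.
  + by apply/allP => j /(allP Ds); exact: DI.
  + by apply: contra Dk => /(allP Ds).
  + by rewrite fineM ?fin_num_measure //= mulrA.
- under eq_Rintegral do rewrite mulrDr.
  under [in RHS]eq_Rintegral do rewrite mulrDr.
  by rewrite !RintegralD ?IHg ?IHh ?mulrDr //; exact: int.
- have e A : \int[P]_w (\1_A w * (\1_(E j) w * g w)) =
             \int[P]_w (\1_(E j `&` A) w * g w).
    by apply: eq_Rintegral => w _; rewrite indicI /= mulrA [X in X * _]mulrC.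
  rewrite !e setICA.
  by have := IH (j :: s); rewrite /= Dj big_cons; exact.
Qed.
End BernoulliPolynomials.

(** * Mirror symmetry of [G*] and the pinned Poincare inequality *)

Section Symmetrization.
Set Implicit Arguments.
Unset Strict Implicit.
Context {n : nat} {R : {set 'I_n}}.
Implicit Types (u v : sym_vertex R) (E : rel 'I_n).

Definition mirror u : sym_vertex R := vtx R (val u).1 (~~ (val u).2).

Lemma vtx_val u : vtx R (val u).1 (val u).2 = u.
Proof.
apply: val_inj => /=; case: u => -[i b] /=; rewrite /vok /= => bR.
by case: b bR => //= ->.
Qed.

Lemma mirror_vtx i b : mirror (vtx R i b) = vtx R i (~~ b).
Proof. by apply: val_inj => /=; case: b; case: (i \notin R). Qed.

Lemma mirrorK : involutive mirror.
Proof. by move=> u; rewrite -[u]vtx_val !mirror_vtx negbK. Qed.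

Lemma mirror_id u : (val u).1 \in R -> mirror u = u.
Proof.
rewrite -{2 3}[u]vtx_val mirror_vtx => uR.
by apply: val_inj => /=; rewrite uR !andbF.
Qed.

Lemma sym_graphP E u v :
  reflect (exists i j b, [/\ E i j, u = vtx R i b & v = vtx R j b])
          (sym_graph E u v).
Proof.
apply: (iffP existsP) => [[i /existsP[j /existsP[b /and3P[Eij /eqP-> /eqP->]]]]|].
  by exists i, j, b.
move=> [i [j [b [Eij -> ->]]]]; exists i; apply/existsP; exists j.
by apply/existsP; exists b; rewrite Eij !eqxx.
Qed.

Lemma sym_graph_fst E u v : sym_graph E u v -> E (val u).1 (val v).1.
Proof. by move=> /sym_graphP[i [j [b [Eij -> ->]]]]. Qed.

Lemma sym_graph_vtx E i j b : E i j -> sym_graph E (vtx R i b) (vtx R j b).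
Proof. by move=> Eij; apply/sym_graphP; exists i, j, b. Qed.

Lemma sym_graph_sym E : symmetric E -> symmetric (@sym_graph n R E).
Proof.
move=> symE; suff imp u v : sym_graph E u v -> sym_graph E v u.
  by move=> u v; apply/idP/idP; exact: imp.
by move=> /sym_graphP[i [j [b [Eij -> ->]]]]; apply: sym_graph_vtx; rewrite symE.
Qed.

Lemma sym_graph_irr E : irreflexive E -> irreflexive (@sym_graph n R E).
Proof. by move=> irrE u; apply/negbTE/negP => /sym_graph_fst; rewrite irrE. Qed.

Lemma sym_graph_mirror E u v : sym_graph E (mirror u) (mirror v) = sym_graph E u v.
Proof.
have imp u' v' : sym_graph E u' v' -> sym_graph E (mirror u') (mirror v').
  move=> /sym_graphP[i [j [b [Eij -> ->]]]].
  by rewrite !mirror_vtx; exact: sym_graph_vtx.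
by apply/idP/idP => [/imp|/imp //]; rewrite !mirrorK.
Qed.

Lemma GtE (G : rel 'I_n) k u v :
  Gt G R k u v = Gstar G R u v && skeep k (val u).1 (val v).1.
Proof.
apply/sym_graphP/andP => [[i [j [b [/andP[Gij kij] -> ->]]]]|].
  by split => //; exact: sym_graph_vtx.
move=> [/sym_graphP[i [j [b [Gij -> ->]]]] kij].
by exists i, j, b; rewrite Gij.
Qed.

(* [deg] is the cardinality of a classical set, hence not covered by [cardsE]. *)
Lemma degE (G : rel 'I_n) u : deg G R u = #|[pred v | Gstar G R u v]|.
Proof.
apply: eq_card => v; rewrite [RHS]inE; apply/idP/idP => [|uv]; last exact/mem_set.
by move=> /set_mem.
Qed.

Lemma skeep_sym (k : rel 'I_n) i j : i != j -> skeep k i j = skeep k j i.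
Proof. by rewrite /skeep -val_eqE; case: (ltngtP i j). Qed.

Lemma card_sym_vertex : (#|{: sym_vertex R}| <= 2 * n)%N.
Proof.
have := @leq_card (sym_vertex R) ('I_n * bool)%type val val_inj.
by rewrite card_prod card_ord card_bool mulnC.
Qed.

Variables (Rl : realType) (a : sym_vertex R -> Rl).

Lemma mirror_weight : (forall i, a (vtx R i true) = a (vtx R i false)) ->
  forall u, a (mirror u) = a u.
Proof.
move=> ab u; rewrite -[u]vtx_val mirror_vtx.
by case: (val u).2 => /=; rewrite ab.
Qed.

Lemma init_mirror (x0 : 'I_n -> Rl) : (forall i, i \in R -> x0 i = 0) ->
  forall u, init R x0 (mirror u) = - init R x0 u.
Proof.
move=> x00 u; have [uR|uR] := boolP ((val u).1 \in R).
  by rewrite mirror_id // /init x00 // oppr0 if_same oppr0.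
rewrite /init /= uR andbT; case: (val u).2 => //=; by rewrite opprK.
Qed.

(** The mirror map is an automorphism of every weighted graph [A t], so the linear dynamics commutes
    with it and preserves antisymmetry. *)
Lemma traj_mirror (x0 : sym_vertex R -> Rl) (A : nat -> rel (sym_vertex R)) :
  (forall u, a (mirror u) = a u) ->
  (forall u, x0 (mirror u) = - x0 u) ->
  (forall t, irreflexive (A t)) ->
  (forall t u v, A t (mirror u) (mirror v) = A t u v) ->
  forall t u, traj a x0 A t (mirror u) = - traj a x0 A t u.
Proof.
move=> am x0m irrA Am; elim=> [|t IH] u; first exact: x0m.
rewrite /= !Pmat_apply // IH am opprD -mulrN -sumrN.
congr (_ + _ * _); rewrite (reindex_inj (inv_inj mirrorK)) /=.
apply: eq_big => [v|v _]; first by rewrite Am.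
by rewrite IH opprB opprK addrC.
Qed.

(** A simple path of [G] from the robot under [u] to [r] lifts to [G*], and the lift ends at a
    vertex where [x] vanishes. *)
Lemma dirichlet_pinned (G : rel 'I_n) (x : sym_vertex R -> Rl) r u :
  (forall i j, connect G i j) -> r \in R ->
  (forall v, (val v).1 \in R -> x v = 0) ->
  x u ^+ 2 <= n%:R ^+ 2 * dirichlet (Gstar G R) x.
Proof.
move=> conn rR x0; case/connectP: (conn (val u).1 r) => s0 s0P s0r.
case: (shortenP s0P) s0r => s sP sU _ rE.
(* The lift keeps the Boolean of [u] throughout; [vtx] resets it on [R], where the two sheets are
   glued. *)
pose b := (val u).2.
have sP' : path (Gstar G R) u (map (fun i => vtx R i b) s).
  rewrite -[u]vtx_val -/b; elim: s (val u).1 sP {sU rE} => //= j s IH i /andP[Gij /IH ->].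
  by rewrite andbT; exact: sym_graph_vtx.
have lastE : last u (map (fun i => vtx R i b) s) = vtx R r b.
  by rewrite -[u]vtx_val -/b (last_map (fun i => vtx R i b)) -rE.
have := dirichlet_path x sP'; rewrite lastE x0 // sub0r normrN size_map => xu.
(* The [size s + 1] vertices of the shortened path are distinct. *)
have sn : (size s <= n)%N.
  have /card_uniqP sz := sU; have := max_card (mem ((val u).1 :: s)).
  by rewrite sz card_ord /= => /ltnW.
rewrite -[dirichlet _ _]sqr_sqrtr ?dirichlet_ge0 // -exprMn -real_normK ?num_real //.
rewrite ler_pXn2r ?nnegrE ?mulr_ge0 ?sqrtr_ge0 //.
by rewrite (le_trans xu) // ler_wpM2r ?sqrtr_ge0 // ler_nat.
Qed.

End Symmetrization.

(** * Expected geometric decay of the potential under random edge deletion *)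

Section RandomDynamics.
Set Implicit Arguments.
Unset Strict Implicit.
Context {Rl : realType} {n : nat} {G : rel 'I_n} {R : {set 'I_n}}.
Variables (a : sym_vertex R -> Rl) (x0 : 'I_n -> Rl).
Context {dsp : measure_display} {Om : measurableType dsp}.
Variables (P : probability Om Rl) (kp : nat -> 'I_n -> 'I_n -> Om -> bool).
Hypotheses (irrG : irreflexive G) (symG : symmetric G).
Implicit Types (u v : sym_vertex R) (t : nat) (w : Om).

Local Notation key := (nat * 'I_n * 'I_n)%type.

(** One key per time and undirected edge of [G], the smaller endpoint first. *)
Definition valid_key : pred key := fun k => (k.1.2 < k.2)%N && G k.1.2 k.2.

(** The bits revealed strictly before time [t]; polynomials in them stand in for the filtration. *)
Definition key_before t : pred key := fun k => valid_key k && (k.1.1 < t)%N.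

Definition kept (k : key) : set Om := [set w | kp k.1.1 k.1.2 k.2 w].

(** Both orientations of an edge and its mirror image share one key, hence one bit. *)
Definition edge_key t u v : key :=
  if ((val u).1 < (val v).1)%N then (t, (val u).1, (val v).1)
  else (t, (val v).1, (val u).1).

Definition position t u w : Rl :=
  traj a (init R x0) (fun s => Gt G R (fun i j => kp s i j w)) t u.

Definition step_graph t w : rel (sym_vertex R) := Gt G R (fun i j => kp t i j w).

Definition potential t w : Rl := energy a (fun u => position t u w).

Lemma edge_key_valid t u v : Gstar G R u v -> valid_key (edge_key t u v).
Proof.
move=> /sym_graph_fst Guv; rewrite /edge_key.
case: (ltngtP (val u).1 (val v).1) => h; last first.
- by exfalso; move: Guv; rewrite (val_inj h) irrG.
- by apply/andP; split => //; rewrite symG.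
- exact/andP.
Qed.

Lemma edge_key_time t u v : (edge_key t u v).1.1 = t.
Proof. by rewrite /edge_key; case: ifP. Qed.

Lemma step_graphE t w u v :
  step_graph t w u v = Gstar G R u v && (w \in kept (edge_key t u v)).
Proof.
rewrite /step_graph GtE; congr (_ && _); apply/idP/idP.
  by rewrite inE /kept /edge_key /skeep /=; case: ifP.
by rewrite inE /kept /edge_key /skeep /=; case: ifP.
Qed.

Lemma step_graph_irr t w : irreflexive (step_graph t w).
Proof. by apply: sym_graph_irr => i; rewrite irrG. Qed.

Lemma step_graph_sym t w : symmetric (step_graph t w).
Proof.
apply: sym_graph_sym => i j; rewrite symG; case Gji: (G j i) => //=.
by apply: skeep_sym; apply: contraTneq Gji => ->; rewrite irrG.
Qed.

Lemma step_graph_sum t w u (F : sym_vertex R -> Rl) :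
  \sum_(v | step_graph t w u v) F v =
  \sum_(v | Gstar G R u v) \1_(kept (edge_key t u v)) w * F v.
Proof.
rewrite big_mkcond [RHS]big_mkcond; apply: eq_bigr => v _.
rewrite step_graphE indicE; case: (Gstar G R u v) => //=.
by case: (_ \in _); rewrite ?mul1r ?mul0r.
Qed.

Lemma step_dirichletE t w (x : sym_vertex R -> Rl) :
  dirichlet (step_graph t w) x = \sum_u \sum_(v | Gstar G R u v)
    \1_(kept (edge_key t u v)) w * (x v - x u) ^+ 2.
Proof. by apply: eq_bigr => u _; rewrite step_graph_sum. Qed.

Lemma positionS t u w : position t.+1 u w = position t u w +
  a u * \sum_(v | Gstar G R u v)
          \1_(kept (edge_key t u v)) w * (position t v w - position t u w).
Proof.
rewrite /position /= Pmat_apply -?step_graph_sum //; exact: step_graph_irr.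
Qed.

(** Adaptedness: the step from [t] to [t.+1] multiplies earlier polynomials by bits of time [t]
    only. *)
Lemma position_bitpoly t u : bitpoly kept (key_before t) (position t u).
Proof.
elim: t u => [|t IH] u; first exact: bitpoly_cst.
have IH' v : bitpoly kept (key_before t.+1) (position t v).
  by apply: bitpoly_sub (IH v) => k /andP[kv kt]; rewrite /key_before kv ltnW.
have -> : position t.+1 u = (fun w => position t u w +
    a u * \sum_(v | Gstar G R u v)
      \1_(kept (edge_key t u v)) w * (position t v w - position t u w)).
  by apply/funext => w; rewrite positionS.
apply: bitpolyD => //; apply/bitpolyZ/bitpoly_sum => v uv.
apply: bitpoly_bit; last exact: bitpolyB.
by rewrite /key_before edge_key_valid // edge_key_time ltnS leqnn.
Qed.

Lemma sqr_diff_bitpoly t u v :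
  bitpoly kept (key_before t) (fun w => (position t v w - position t u w) ^+ 2).
Proof.
under eq_fun do rewrite expr2.
by apply: bitpolyM; apply: bitpolyB; exact: position_bitpoly.
Qed.

Lemma dirichlet_bitpoly t :
  bitpoly kept (key_before t) (fun w => dirichlet (Gstar G R) (position t ^~ w)).
Proof. by do 2 apply: bitpoly_sum => ? _; exact: sqr_diff_bitpoly. Qed.

Lemma step_dirichlet_bitpoly t : bitpoly kept valid_key
  (fun w => dirichlet (step_graph t w) (position t ^~ w)).
Proof.
under eq_fun do rewrite step_dirichletE.
apply: bitpoly_sum => u _; apply: bitpoly_sum => v uv.
apply: bitpoly_bit; first exact: edge_key_valid.
by apply: bitpoly_sub (sqr_diff_bitpoly t u v) => k /andP[].
Qed.

Lemma potential_bitpoly t : bitpoly kept (key_before t) (potential t).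
Proof.
apply: bitpoly_sum => u _.
under eq_fun do rewrite mulrC expr2.
by apply/bitpolyZ/bitpolyM; exact: position_bitpoly.
Qed.

Hypothesis a_bounds : forall u, 0 < a u /\ a u < 1 / ((deg G R u).+1)%:R.

Let a_gt0 u : 0 < a u. Proof. by case: (a_bounds u). Qed.

Lemma weight_le1 u : a u <= 1.
Proof.
case: (a_bounds u) => _ /ltW h; apply: (le_trans h).
by rewrite ler_pdivrMr ?ltr0n // mul1r ler1n.
Qed.

Lemma potential_ge0 t w : 0 <= potential t w.
Proof. exact: energy_ge0. Qed.

(** With [k] the degree of [u] in [G*], the product is at most [k / (k + 1) = 1 - 1 / (k + 1)],
    which increases with [k]. This supplies the constant [c] of [energy_step]. *)
Lemma weight_degree t w u :
  a u * #|[pred v | step_graph t w u v]|%:R <= 1 - ((maxdeg G R).+1)%:R^-1.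
Proof.
have [_ /ltW au] := a_bounds u; move: au.
have : (#|[pred v | step_graph t w u v]| <= deg G R u)%N.
  rewrite degE; apply: subset_leq_card; apply/fintype.subsetP => v.
  by rewrite !inE step_graphE => /andP[].
have : (deg G R u <= maxdeg G R)%N by exact: leq_bigmax.
set k := #|_|; set d := deg _ _ _; set D := maxdeg _ _ => dD kd au.
apply: (@le_trans _ _ (1 / d.+1%:R * d%:R)).
  by apply: ler_pM => //; [exact: ltW|rewrite ler_nat].
have d0 : (0 : Rl) < d.+1%:R by rewrite ltr0n.
have -> : (1 / d.+1%:R * d%:R : Rl) = 1 - d.+1%:R^-1.
  have -> : (d%:R : Rl) = d.+1%:R - 1 by rewrite -natr1 addrK.
  by field; exact: lt0r_neq0.
by rewrite lerD2l lerN2 lef_pV2 ?posrE ?ltr0n // ler_nat.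
Qed.

Lemma potential_step t w : potential t.+1 w <=
  potential t w - ((maxdeg G R).+1)%:R^-1 *
                  dirichlet (step_graph t w) (position t ^~ w).
Proof.
apply: energy_step => //; [exact: step_graph_sym|exact: step_graph_irr|].
exact: weight_degree.
Qed.

Lemma potential_mono t s w : (s <= t)%N -> potential t w <= potential s w.
Proof.
elim: t => [|t IH]; first by rewrite leqn0 => /eqP->.
rewrite leq_eqVlt => /predU1P[->//|/IH]; apply: le_trans.
apply: le_trans (potential_step t w) _.
by rewrite gerBl mulr_ge0 ?dirichlet_ge0.
Qed.

Hypothesis kp_meas : forall t i j, measurable [set w | kp t i j w].
Variable p : Rl.
Hypothesis kp_indep : indep_bern P p valid_key kept.

Let kept_meas k : measurable (kept k). Proof. exact: kp_meas. Qed.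

(** By linearity each ordered pair is treated alone, so bits shared by mirror edges do no harm: the
    bit has time [t], and the squared difference depends only on earlier bits. *)
Lemma Rintegral_step_dirichlet t :
  \int[P]_w dirichlet (step_graph t w) (position t ^~ w) =
  p * \int[P]_w dirichlet (Gstar G R) (position t ^~ w).
Proof.
have pv u v : bitpoly kept valid_key (fun w => (position t v w - position t u w) ^+ 2).
  by apply: bitpoly_sub (sqr_diff_bitpoly t u v) => k /andP[].
have bv u v : Gstar G R u v -> bitpoly kept valid_key (fun w =>
    \1_(kept (edge_key t u v)) w * (position t v w - position t u w) ^+ 2).
  by move=> uv; apply: bitpoly_bit => //; exact: edge_key_valid.
under eq_Rintegral do rewrite step_dirichletE.
rewrite (Rintegral_bitpoly_sum P kept_meas (D := valid_key)); last first.
  by move=> u _; apply: bitpoly_sum => v; exact: bv.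
rewrite (Rintegral_bitpoly_sum P kept_meas (D := valid_key)); last first.
  by move=> u _; apply: bitpoly_sum => v _; exact: pv.
rewrite mulr_sumr; apply: eq_bigr => u _.
rewrite (Rintegral_bitpoly_sum P kept_meas (D := valid_key)); last by move=> v; exact: bv.
rewrite (Rintegral_bitpoly_sum P kept_meas (D := valid_key)); last by move=> v _; exact: pv.
rewrite mulr_sumr; apply: eq_bigr => v uv.
apply: (Rintegral_bit kept_meas kp_indep (D := key_before t)).
- exact: edge_key_valid.
- by rewrite /key_before edge_key_time ltnn andbF.
- by move=> k /andP[].
- exact: sqr_diff_bitpoly.
Qed.

Hypotheses (connG : forall i j, connect G i j) (Rn0 : R != finset.set0).
Hypothesis a_mirror : forall i, a (vtx R i true) = a (vtx R i false).
Hypothesis x0_pinned : forall i, i \in R -> x0 i = 0.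

(** A pinned vertex is its own mirror image, so antisymmetry makes its position equal to its own
    negative. *)
Lemma position_pinned t w v : (val v).1 \in R -> position t v w = 0.
Proof.
move=> /mirror_id vE; have : position t (mirror v) w = - position t v w.
  apply: traj_mirror.
  - exact: mirror_weight.
  - exact: init_mirror.
  - by move=> s; exact: step_graph_irr.
  - by move=> s u1 u2; exact: sym_graph_mirror.
by rewrite vE => /eqP; rewrite -addr_eq0 -mulr2n mulrn_eq0 => /eqP.
Qed.

Lemma position_dirichlet t w u :
  position t u w ^+ 2 <= n%:R ^+ 2 * dirichlet (Gstar G R) (position t ^~ w).
Proof.
case/set0Pn: Rn0 => r rR.
by apply: (dirichlet_pinned u connG rR) => v; exact: position_pinned.
Qed.

Variable rho : Rl.
Hypotheses (rho_gt0 : 0 < rho) (rho_le : forall u, rho <= a u).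

(** Poincare inequality: at most [2 * n] vertices, each contributing at most [n ^ 2 / rho] times the
    Dirichlet form. *)
Lemma potential_dirichlet t w : rho / (2 * n%:R ^+ 3) * potential t w <=
  dirichlet (Gstar G R) (position t ^~ w).
Proof.
set D := dirichlet _ _; have D0 : 0 <= D by exact: dirichlet_ge0.
have n0 : (0 : Rl) < n%:R.
  by case/set0Pn: Rn0 => -[i lt_i] _; rewrite ltr0n (leq_ltn_trans _ lt_i).
have := energy_le rho_gt0 rho_le (position_dirichlet t w).
rewrite -/(potential t w) -/D ler_pdivlMr // => h.
rewrite mulrAC ler_pdivrMr ?mulr_gt0 ?exprn_gt0 // mulrC (le_trans h) //.
have -> : D * (2 * n%:R ^+ 3) = (2 * n)%:R * (n%:R ^+ 2 * D) by rewrite natrM; ring.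
rewrite ler_wpM2r ?mulr_ge0 ?exprn_ge0 // ler_nat; exact: card_sym_vertex.
Qed.

(** Product of the retention probability [p], the one-step drop [1 / (d + 1)] and the Poincare
    constant [rho / (2 * n ^ 3)]. *)
Definition rate : Rl := p * rho / (2 * n%:R ^+ 3 * ((maxdeg G R).+1)%:R).

Lemma Rintegral_potential_step t : 0 <= p ->
  \int[P]_w potential t.+1 w <= (1 - rate) * \int[P]_w potential t w.
Proof.
move=> p0.
have int f : bitpoly kept valid_key f -> P.-integrable setT (EFin \o f).
  exact: bitpoly_integrable.
have polyP s : bitpoly kept valid_key (potential s).
  by apply: bitpoly_sub (potential_bitpoly s) => k /andP[].
have polyD : bitpoly kept valid_key
    (fun w => dirichlet (Gstar G R) (position t ^~ w)).
  by apply: bitpoly_sub (dirichlet_bitpoly t) => k /andP[].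
have polyS := step_dirichlet_bitpoly t.
pose c : Rl := ((maxdeg G R).+1)%:R^-1.
have c0 : 0 <= c by rewrite invr_ge0.
have polyCS := bitpolyZ c polyS.
have : \int[P]_w potential t.+1 w <= \int[P]_w (potential t w -
     c * dirichlet (step_graph t w) (position t ^~ w)).
  apply: le_Rintegral => //; last by move=> w _; exact: potential_step.
    exact: int.
  by apply/int/bitpolyB.
rewrite RintegralB //; [|exact: int|exact: int].
rewrite RintegralZl //; last exact: int.
rewrite Rintegral_step_dirichlet => h; apply: (le_trans h).
have : rho / (2 * n%:R ^+ 3) * \int[P]_w potential t w <=
    \int[P]_w dirichlet (Gstar G R) (position t ^~ w).
  rewrite -RintegralZl //; last exact: int.
  apply: le_Rintegral => //.
  - exact/int/bitpolyZ.
  - exact: int.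
  - by move=> w _; exact: potential_dirichlet.
move=> /(ler_wpM2l (mulr_ge0 c0 p0)).
have -> : rate = c * p * (rho / (2 * n%:R ^+ 3)) by rewrite /rate /c !invfM; ring.
rewrite !mulrA; lra.
Qed.

(** The prefactor bounds the initial energy: at most [2 * n] vertices, squares at most 1, weights at
    least [rho]. *)
Lemma Rintegral_potential t : 0 <= p -> rate <= 1 ->
  (forall i, 0 <= x0 i <= 1) ->
  \int[P]_w potential t w <= 2 * n%:R / rho * (1 - rate) ^+ t.
Proof.
move=> p0 r1 x01; elim: t => [|t IH].
  have -> : \int[P]_w potential 0 w = \int[P]_(w in setT) energy a (init R x0) by [].
  rewrite expr0 mulr1 Rintegral_cst //.
  have P1 : fine (P setT) = 1 by rewrite probability_setT.
  rewrite [fine _]P1 mulr1.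
  have x1 (u : sym_vertex R) : init R x0 u ^+ 2 <= 1.
    have /andP[h0 h1] := x01 (val u).1.
    by rewrite /init; case: ifP => _; rewrite ?sqrrN expr_le1.
  apply: (le_trans (energy_le rho_gt0 rho_le x1)).
  rewrite mulr1 ler_pM2r ?invr_gt0 // -natrM ler_nat; exact: card_sym_vertex.
apply: (le_trans (Rintegral_potential_step _ p0)).
by rewrite exprS mulrCA ler_wpM2l // subr_ge0.
Qed.

End RandomDynamics.

(** * From decay of a nonincreasing potential to the expected last time *)

Section LastTime.
Set Implicit Arguments.
Unset Strict Implicit.
Context {Rl : realType}.

Lemma Tlast_ge0 (V : finType) (eps : Rl) (x : nat -> V -> Rl) : (0 <= Tlast eps x)%E.
Proof. by apply: ereal_sup_ubound; left. Qed.

(** If the spread is large at some [t > s0], monotonicity gives [phi >= 1] at all times from [s0] to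
    [t], so the tail sum is at least [t - s0]. *)
Lemma Tlast_le (V : finType) (eps : Rl) (x : nat -> V -> Rl) (phi : nat -> Rl) s0 :
  (forall t, 0 <= phi t) -> {homo phi : s t / (s <= t)%N >-> t <= s} ->
  (forall t, spread_gt eps (x t) -> 1 <= phi t) ->
  (Tlast eps x <= s0%:R%:E + \sum_(k <oo) (phi (s0 + k)%N)%:E)%E.
Proof.
move=> phi0 phi_mono phi1.
have S0 : (0 <= \sum_(k <oo) (phi (s0 + k)%N)%:E)%E.
  by apply: nneseries_ge0 => k _ _; rewrite lee_fin.
apply: ge_ereal_sup => _ [->|[t /= xt <-]]; first by rewrite adde_ge0 // lee_fin.
have [ts0|s0t] := leqP t s0.
  by rewrite (@le_trans _ _ (s0%:R%:E)) ?lee_fin ?ler_nat // leeDl.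
have := @nneseries_lim_ge Rl (fun k => (phi (s0 + k)%N)%:E) xpredT 0 (t - s0)%N.
have h k : (0 <= k)%N -> true -> (0 <= (phi (s0 + k)%N)%:E)%E by rewrite lee_fin.
move=> /(_ h) le_S; apply: le_trans (leeD2l _ le_S).
rewrite sumEFin -EFinD lee_fin -{1}(subnKC (ltnW s0t)) natrD lerD2l.
rewrite -[(t - s0)%N in leLHS]subn0 -[leLHS]mulr1 mulr_natl -sumr_const_nat.
apply: ler_sum_nat => k; rewrite /= ltn_subRL => kt.
by apply: (le_trans (phi1 t xt)); apply: phi_mono; exact: ltnW.
Qed.

(* Unlike [ge0_le_integral], no measurability is assumed, so that of [Tlast] is
   never needed. *)
Lemma le_integral_ge0 (dsp : measure_display) (Om : measurableType dsp)
    (mu : {measure set Om -> \bar Rl}) (f g : Om -> \bar Rl) :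
  (forall w, 0 <= f w)%E -> (forall w, f w <= g w)%E ->
  (\int[mu]_w f w <= \int[mu]_w g w)%E.
Proof.
move=> f0 fg.
rewrite !ge0_integralTE //; last by move=> w; exact: le_trans (f0 w) (fg w).
apply: le_ereal_sup => _ [h hf <-]; exists h => // w.
exact: le_trans (hf w) (fg w).
Qed.

Lemma geometric_sum_le (q : Rl) N : 0 <= q < 1 ->
  \sum_(0 <= k < N) q ^+ k <= (1 - q)^-1.
Proof.
move=> /andP[q0 q1]; rewrite -[leRHS]mul1r ler_pdivlMr ?subr_gt0 //.
rewrite (_ : _ * _ = 1 - q ^+ N); first by rewrite gerBl exprn_ge0.
elim: N => [|N IH]; first by rewrite big_nil mul0r expr0 subrr.
by rewrite big_nat_recr //= mulrDl IH exprS; ring.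
Qed.

(** Integrate the pointwise bound of [Tlast_le] term by term, which nonnegativity allows, and sum
    the geometric tail. *)
Lemma integral_Tlast_le (dsp : measure_display) (Om : measurableType dsp)
    (P : probability Om Rl) (V : finType) (eps : Rl) (x : Om -> nat -> V -> Rl)
    (phi : nat -> Om -> Rl) (B q : Rl) s0 :
  (forall t, P.-integrable setT (EFin \o phi t)) ->
  (forall t w, 0 <= phi t w) ->
  (forall s t w, (s <= t)%N -> phi t w <= phi s w) ->
  (forall t w, spread_gt eps (x w t) -> 1 <= phi t w) ->
  0 <= B -> 0 <= q < 1 ->
  (forall t, \int[P]_w phi t w <= B * q ^+ t) ->
  (\int[P]_w Tlast eps (x w) <= (s0%:R + B * q ^+ s0 / (1 - q))%:E)%E.
Proof.
move=> iphi phi0 phi_mono phi1 B0 q01 phiB.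
apply: (@le_trans _ _
    (\int[P]_w (s0%:R%:E + \sum_(k <oo) (phi (s0 + k)%N w)%:E))%E).
  apply: le_integral_ge0 => w; first exact: Tlast_ge0.
  apply: (@Tlast_le _ _ _ (phi^~ w)) => // [s t|t]; [exact: phi_mono|exact: phi1].
have mphi t : measurable_fun setT (EFin \o phi t) by exact: measurable_int (iphi t).
rewrite ge0_integralD //=; last 2 first.
- by move=> w _; apply: nneseries_ge0 => k _ _; rewrite lee_fin.
- apply: ge0_emeasurable_sum => [k w _ _|k _]; [by rewrite lee_fin|exact: mphi].
have P1 : P setT = 1%E by exact: probability_setT.
rewrite integral_cst // [X in (_ * X)%E]P1 mule1 EFinD leeD2l //.
rewrite integral_nneseries //; last 2 first.
- by move=> k; exact: mphi.
- by move=> k w _; rewrite lee_fin.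
have e k : (\int[P]_w (phi (s0 + k)%N w)%:E)%E = (\int[P]_w phi (s0 + k)%N w)%:E.
  by rewrite /Rintegral fineK //; exact: (integrable_fin_num measurableT (iphi _)).
apply: (@le_trans _ _ (\sum_(k <oo) (B * q ^+ s0 * q ^+ k)%:E)%E).
  apply: lee_nneseries => k _; first by rewrite e lee_fin Rintegral_ge0.
  by rewrite e lee_fin -mulrA -exprD.
have /andP[q0 _] := q01.
have A0 : 0 <= B * q ^+ s0 by rewrite mulr_ge0 ?exprn_ge0.
apply: lime_le.
  by apply: is_cvg_nneseries => k _ _; rewrite lee_fin mulr_ge0 ?exprn_ge0.
apply: nearW => N; rewrite sumEFin lee_fin -mulr_sumr ler_wpM2l //.
exact: geometric_sum_le.
Qed.

End LastTime.

(** * Choice of the waiting time and the final bound *)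

Lemma expr_oneB_le_expR (Rl : realType) (l : Rl) (m : nat) : l <= 1 ->
  (1 - l) ^+ m <= expR (- (l * m%:R)).
Proof.
move=> l1; rewrite -mulNr expRM_natr lerXn2r ?nnegrE ?subr_ge0 ?expR_ge0 //.
exact: expR_ge1Dx.
Qed.

(** From [ln z <= z - 1] at [z = 1 / y]. It serves to absorb additive constants into the
    logarithm. *)
Lemma ln_ge_half (Rl : realType) (y : Rl) : 4 <= y -> 2^-1 <= ln y.
Proof.
move=> y4; have y0 : 0 < y by lra.
have : ln y^-1 <= y^-1 - 1.
  rewrite -{1}[y^-1](subrKC 1); apply: le_ln1Dx.
  have : 0 < y^-1 by rewrite invr_gt0.
  lra.
rewrite lnV ?posrE //; have : y^-1 <= 4^-1 by rewrite lef_pV2 ?posrE.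
lra.
Qed.

(** Just past [ln K / l] steps, [K * (1 - l) ^ s] has dropped to at most 1. The tail then costs
    [1 / l], and rounding up costs 1, again at most [1 / l]. *)
Lemma waiting_time (Rl : realType) (l K : Rl) : 0 < l <= 1 -> 1 <= K ->
  exists s : nat, s%:R + K * (1 - l) ^+ s / l <= (ln K + 2) / l.
Proof.
move=> /andP[l0 l1] K1; have K0 : 0 < K by lra.
have lnK0 : 0 <= ln K / l by apply: divr_ge0; [exact: ln_ge0|exact: ltW].
exists (Num.truncn (ln K / l)).+1; set s := _.+1.
have sl : ln K <= l * s%:R.
  by rewrite mulrC -ler_pdivrMr // ltW // -truncn_le_nat.
have su : s%:R <= ln K / l + l^-1.
  rewrite -natr1 lerD ?truncn_le //.
  by rewrite -[leLHS]invr1 lef_pV2 ?posrE.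
have : K * (1 - l) ^+ s <= 1.
  apply: (@le_trans _ _ (K * expR (- (l * s%:R)))).
    by rewrite ler_pM2l // expr_oneB_le_expR.
  rewrite -[K in leLHS]lnK ?posrE // -expRD -[leRHS]expR0 ler_expR; lra.
move=> /ler_wpM2r - /(_ l^-1); rewrite invr_ge0 mul1r => /(_ (ltW l0)) h.
rewrite mulrDl; lra.
Qed.

Theorem theorem4 (Rl : realType) :
  exists C : Rl, 0 < C /\
  forall (n : nat) (G : rel 'I_n) (R : {set 'I_n}) (a : sym_vertex R -> Rl)
    (rho p eps : Rl) (x0 : 'I_n -> Rl)
    (dsp : measure_display) (Om : measurableType dsp) (P : probability Om Rl)
    (kp : nat -> 'I_n -> 'I_n -> Om -> bool),
    irreflexive G -> symmetric G -> (forall i j, connect G i j) ->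
    R != finset.set0 ->
    (forall u, 0 < a u /\ a u < 1 / ((deg G R u).+1)%:R) ->
    (forall i, a (vtx R i true) = a (vtx R i false)) ->
    (forall u, rho <= a u) -> (exists u, a u = rho) ->
    0 < p <= 1 -> 0 < eps < 1 ->
    (forall i, 0 <= x0 i <= 1) -> (forall i, i \in R -> x0 i = 0) ->
    (forall t i j, measurable [set w | kp t i j w]) ->
    indep_bern P p (fun k : nat * 'I_n * 'I_n => (k.1.2 < k.2)%N && G k.1.2 k.2)
      (fun k => [set w | kp k.1.1 k.1.2 k.2 w]) ->
    (\int[P]_w Tlast eps (traj a (init R x0)
                            (fun t => Gt G R (fun i j => kp t i j w)))
      <= (C * ((maxdeg G R)%:R ^+ 2 * n%:R ^+ 4 / (p ^+ 3 * rho ^+ 2))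
            * ln (n%:R / (rho * eps)))%:E)%E.
Proof.
(* [32 = 8 * 2 * 2]: from [ln K + 2 <= 8 * L], the 2 in [rate], and [d + 1 <= 2 * d ^ 2]. *)
exists 32; split; first by [].
move=> n G R a rho p eps x0 dsp Om P kp irrG symG connG Rn0 aB aM rho_le [u0 au0].
move=> /andP[p0 p1] /andP[e0 e1] x01 x0R mkp indep.
have rho0 : 0 < rho by rewrite -au0; case: (aB u0).
have a0 u : 0 < a u by case: (aB u).
(* If [d = 0] the claimed bound is 0, so the last time must vanish exactly: without edges the
   Dirichlet form is 0, which forces every position to 0. *)
have [d0|d_gt0] := posnP (maxdeg G R).
  have noedge u v : Gstar G R u v = false.
    have : (deg G R u <= 0)%N by rewrite -d0; exact: leq_bigmax.
    by rewrite degE leqn0 => /pred0P /(_ v).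
  have x00 t w u : traj a (init R x0) (fun t => Gt G R (fun i j => kp t i j w)) t u = 0.
    apply/eqP; rewrite -sqrf_eq0 eq_le sqr_ge0 andbT.
    apply: (le_trans (position_dirichlet kp irrG connG Rn0 aM x0R t w u)).
    rewrite /dirichlet big1 ?mulr0 // => v _.
    by rewrite big_pred0 // => v'; exact: noedge.
  rewrite d0 expr0n /= !mul0r mulr0 mul0r.
  rewrite integral0_eq // => w _; apply/eqP; rewrite eq_le Tlast_ge0 andbT.
  apply: ge_ereal_sup => z [->//|[t /= [u [v uv]] _]].
  by move: uv; rewrite !x00 subrr => /(lt_trans e0); rewrite ltxx.
(* An edge forces [n >= 2] and [rho <= 1/2], so the argument of the logarithm is at least 4. *)
have [u1 [v1 uv1]] : exists u v, Gstar G R u v.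
  have V_gt0 : (0 < #|{: sym_vertex R}|)%N by apply/card_gt0P; exists u0.
  have [u ud] := bigop.eq_bigmax (deg G R) V_gt0.
  by move: d_gt0; rewrite /maxdeg ud degE => /card_gt0P[v uv]; exists u, v.
have n2 : (2 : Rl) <= n%:R.
  rewrite ler_nat ltnNge; apply/negP => n1.
  have /sym_graph_fst := uv1.
  suff -> : (val u1).1 = (val v1).1 by rewrite irrG.
  apply/val_inj; have := leq_trans (ltn_ord (val u1).1) n1.
  have := leq_trans (ltn_ord (val v1).1) n1.
  by rewrite !ltnS !leqn0 => /eqP v0 /eqP u0E; exact: etrans u0E (esym v0).
have rho_half : rho <= 2^-1.
  apply: (le_trans (rho_le u1)); case: (aB u1) => _ /ltW /le_trans; apply.
  rewrite div1r lef_pV2 ?posrE ?ltr0n // (ler_nat _ 2) ltnS degE.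
  by apply/card_gt0P; exists v1.
have d1 : (1 : Rl) <= (maxdeg G R)%:R by rewrite ler1n.
set d : Rl := (maxdeg G R)%:R in d1 *.
pose l : Rl := rate (G := G) (R := R) p rho.
have lE : l = p * rho / (2 * n%:R ^+ 3 * (d + 1)) by rewrite /l /rate natr1.
set N : Rl := n%:R in n2 lE *.
have N0 : 0 < N by lra.
have D0 : 0 < 2 * N ^+ 3 * (d + 1) by rewrite !mulr_gt0 ?exprn_gt0 //; lra.
have l0 : 0 < l by rewrite lE; apply: divr_gt0 => //; exact: mulr_gt0.
have l1 : l <= 1.
  rewrite lE ler_pdivrMr // mul1r.
  have : 1 <= N ^+ 3 by rewrite exprn_ege1 //; lra.
  by nra.
(* The initial bound [2 * N / rho] on the expected potential, rescaled by [4 / eps ^ 2]. *)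
pose K : Rl := 8 * N / (rho * eps ^+ 2).
pose y : Rl := N / (rho * eps).
have re0 : 0 < rho * eps by rewrite mulr_gt0.
have y4 : 4 <= y by rewrite /y ler_pdivlMr //; nra.
have KE : K = 8 / N * rho * y ^+ 2.
  by rewrite /K /y; field; rewrite !lt0r_neq0.
(* Replaces [ln K], with its [eps ^ 2], by [4 * ln y]; here [8 * rho / N <= 4 <= y ^ 2]. *)
have K_le : K <= y ^+ 4.
  rewrite KE (_ : y ^+ 4 = y ^+ 2 * y ^+ 2); last by ring.
  rewrite ler_wpM2r ?sqr_ge0 //.
  apply: (@le_trans _ _ 4); last by nra.
  rewrite mulrAC ler_pdivrMr //; nra.
have K1 : 1 <= K by rewrite /K ler_pdivlMr ?mulr_gt0 ?exprn_gt0 //; nra.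
have l01 : 0 < l <= 1 by rewrite l0.
have [s hs] := @waiting_time Rl l K l01 K1.
(* The factor [4 / eps ^ 2] makes the potential at least 1 whenever the spread exceeds [eps]. *)
have h := @integral_Tlast_le Rl dsp Om P _ eps
  (fun w t u => position (G := G) a x0 kp t u w)
  (fun t w => 4 / eps ^+ 2 * potential (G := G) a x0 kp t w) K (1 - l) s.
apply: (le_trans (h _ _ _ _ _ _ _)).
- move=> t; apply: bitpoly_integrable; last first.
    by apply: bitpolyZ; exact: potential_bitpoly.
  by move=> k; exact: mkp.
- move=> t w; rewrite mulr_ge0 ?potential_ge0 ?divr_ge0 ?sqr_ge0 //.
- move=> s1 t w st; rewrite ler_wpM2l ?divr_ge0 ?sqr_ge0 //; exact: potential_mono.
- move=> t w /(spread_gt_energy e0 a0 (weight_le1 aB)).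
  rewrite -/(potential (G := G) a x0 kp t w) ler_pdivrMr // => hh.
  by rewrite mulrAC ler_pdivlMr ?exprn_gt0 // mul1r mulrC.
- by lra.
- by apply/andP; split; lra.
- move=> t; rewrite RintegralZl //; last first.
    apply: bitpoly_integrable; last exact: potential_bitpoly.
    by move=> k; exact: mkp.
  have -> : K = 4 / eps ^+ 2 * (2 * N / rho) by rewrite /K; field; rewrite !lt0r_neq0.
  rewrite -[leRHS]mulrA ler_wpM2l ?divr_ge0 ?sqr_ge0 //.
  exact: (Rintegral_potential irrG symG aB mkp indep connG Rn0 aM x0R
            rho0 rho_le _ (ltW p0) l1 x01).
rewrite lee_fin subKr; apply: (le_trans hs); rewrite -/y.
set L := ln y.
have L2 : 2^-1 <= L by exact: ln_ge_half.
have y0 : 0 < y by lra.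
have lnK4 : ln K <= 4 * L.
  have : ln K <= ln (y ^+ 4) by rewrite ler_ln ?posrE ?exprn_gt0 //; lra.
  by rewrite lnXn // -[ln y *+ 4]mulr_natl.
(* [L >= 1/2] gives [2 <= 4 * L], hence [ln K + 2 <= 8 * L]. *)
apply: (@le_trans _ _ (8 * L / l)).
  by rewrite ler_pM2r ?invr_gt0 //; lra.
rewrite mulrAC ler_wpM2r //; first by lra.
rewrite lE invf_div mulrA ler_pdivrMr ?mulr_gt0 //.
have -> : 32 * (d ^+ 2 * N ^+ 4 / (p ^+ 3 * rho ^+ 2)) * (p * rho) =
    32 * (d ^+ 2 * N ^+ 4) / (p ^+ 2 * rho).
  by field; rewrite !lt0r_neq0.
(* The bound of order [d * n ^ 3 / (p * rho)] is weakened to the stated one, using [d >= 1],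
   [N >= 1] and [p ^ 2 * rho <= 1]. *)
apply: (@le_trans _ _ (32 * (d ^+ 2 * N ^+ 4))).
  have dd : d + 1 <= 2 * d ^+ 2 by nra.
  have NN : N ^+ 3 <= N ^+ 4 by rewrite ler_eXn2l //; lra.
  have N30 : 0 <= N ^+ 3 by rewrite exprn_ge0 // ltW.
  have : N ^+ 3 * (d + 1) <= N ^+ 4 * (2 * d ^+ 2) by rewrite ler_pM //; lra.
  by lra.
rewrite ler_peMr ?mulr_ge0 ?exprn_ge0 //.
rewrite invf_ge1 ?mulr_gt0 ?exprn_gt0 // mulr_ile1 ?exprn_ge0 ?exprn_ile1 //; lra.
Qed.
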